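(* For a topological space $(X,\tau)$ the following conditions are equivalent: (1) $X$ is a semi-$R_0$-space; (2) every simply-open subset of $X$ is a $V_s$-set; (3) every open subset of $X$ is a $V_s$-set.
   Context: Let $(X,\tau)$ be a topological space. A subset $A\subseteq X$ is semi-open if there is $O\in\tau$ with $O\subseteq A\subseteq \mathrm{Cl}(O)$; a subset is semi-closed if its complement is semi-open. The semi-closure $\mathrm{sCl}(A)$ is the intersection of all semi-closed sets containing $A$. For $B\subseteq X$, $B^{V_s}=\bigcup\{F : F\subseteq B,\ F \text{ semi-closed}\}$, and $B$ is a $V_s$-set (as a subset of $X$) if $B=B^{V_s}$. A subset is simply-open (also called locally semi-closed) if it is the union of an open set and a nowhere dense set. The space $(X,\tau)$ is a semi-$R_0$-space if every semi-open set contains the semi-closure of each of its singletons, i.e. for every semi-open $U$ and $x\in U$, $\mathrm{sCl}(\{x\})\subseteq U$. *)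

(* Defs.v *)
From mathcomp Require Import all_boot.
From mathcomp Require Import boolp classical_sets topology_structure.

Set Implicit Arguments.
Unset Strict Implicit.
Unset Printing Implicit Defensive.

Local Open Scope classical_set_scope.

Definition semi_open (X : topologicalType) (A : set X) : Prop :=
  exists O : set X, [/\ open O, O `<=` A & A `<=` closure O].

Definition semi_closed (X : topologicalType) (A : set X) : Prop :=
  semi_open (~` A).

Definition semi_closure (X : topologicalType) (A : set X) : set X :=
  \bigcap_(F in [set F | semi_closed F /\ A `<=` F]) F.

Definition Vs_kernel (X : topologicalType) (B : set X) : set X :=
  \bigcup_(F in [set F | F `<=` B /\ semi_closed F]) F.

Definition Vs_set (X : topologicalType) (B : set X) : Prop :=
  B = Vs_kernel B.

Definition nowhere_dense (X : topologicalType) (A : set X) : Prop :=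
  interior (closure A) = set0.

Definition simply_open (X : topologicalType) (A : set X) : Prop :=
  exists O N : set X, [/\ open O, nowhere_dense N & A = O `|` N].

Definition semi_R0_space (X : topologicalType) : Prop :=
  forall (U : set X) (x : X), semi_open U -> U x ->
    semi_closure [set x] `<=` U.

(* Main.v *)
(* A set F is semi-closed iff its closure has interior contained in F, so a
   point of a nowhere dense set is a semi-closed singleton.  A simply-open set
   O `|` N, and likewise a semi-open set O `<=` A `<=` closure O, is an open set
   together with points of a nowhere dense set, so being a V_s-set, which is the
   inclusion of the semi-closures of its points, only matters on the open part. *)
Require Import Defs.
From mathcomp Require Import all_boot.
From mathcomp Require Import boolp classical_sets topology_structure.

Local Open Scope classical_set_scope.

Lemma semi_closedP {X : topologicalType} (F : set X) :
  semi_closed F <-> interior (closure F) `<=` F.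
Proof.
split=> [[O [oO OF FO]]|clF].
  have clFO : closure F `<=` ~` O.
    rewrite (closure_id (~` O)).1; last exact: open_closedC.
    by apply: closureS; exact: subsetCr.
  by apply: subset_trans (interiorS clFO) _; rewrite interiorC; exact: subsetCl.
(* The largest open set missing [F] is the best witness. *)
exists (~` closure F); split.
- by apply: closed_openC; exact: closed_closure.
- by apply: subsetC; exact: subset_closure.
- by rewrite closure_setC; exact: subsetC.
Qed.

Lemma semi_open_open {X : topologicalType} (O : set X) : open O -> semi_open O.
Proof. by move=> oO; exists O; split=> //; exact: subset_closure. Qed.

(** The criterion of [semi_closedP] survives arbitrary intersections, as interior and closure are
    monotone. *)
Lemma semi_closed_semi_closure {X : topologicalType} (A : set X) :
  semi_closed (semi_closure A).
Proof.
apply/semi_closedP => x Ax F [sF AF]; apply: ((semi_closedP _).1 sF).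
by apply: interiorS Ax; apply: closureS => y; apply.
Qed.

(** Among semi-closed sets containing [x], [semi_closure [set x]] is the least, so it is the only
    piece of the union to test at [x]. *)
Lemma Vs_setP {X : topologicalType} (B : set X) :
  Vs_set B <-> forall x, B x -> semi_closure [set x] `<=` B.
Proof.
split=> [BV x|BV].
  rewrite BV => -[F [FB sF] Fx] y; rewrite -BV.
  by move=> /(_ F) /= yF; apply/FB/yF; split=> // _ ->.
apply/seteqP; split=> [x Bx|x [F [FB _] /FB//]].
exists (semi_closure [set x]); last by move=> F [_]; apply.
by split; [exact: BV|exact: semi_closed_semi_closure].
Qed.

Lemma nowhere_dense_semi_closure1 {X : topologicalType} {N : set X} {x : X} :
  nowhere_dense N -> N x -> semi_closure [set x] = [set x].
Proof.
move=> N0 Nx; apply/seteqP; split=> [y|y -> F [_]]; last exact.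
apply; split=> //; apply/semi_closedP; apply: (@subset_trans _ set0) => //.
by rewrite -N0; apply/interiorS/closureS => _ ->.
Qed.

(** An interior point would lie both in [closure O] and in the interior of the complement of [O],
    which are disjoint. *)
Lemma nowhere_dense_frontier {X : topologicalType} {O : set X} :
  open O -> nowhere_dense (closure O `\` O).
Proof.
move=> oO; rewrite /nowhere_dense -(closure_id _).1; last first.
  by apply: closedI; [exact: closed_closure|exact: open_closedC].
rewrite -subset0 setDE interiorI interiorC => x [cOx].
by apply; exact: interior_subset.
Qed.

Theorem theorem3p11 (X : topologicalType) :
  [<-> semi_R0_space X;
       forall A : set X, simply_open A -> Vs_set A;
       forall A : set X, open A -> Vs_set A].
Proof.
tfae=> [R0 A [O [N [oO N0 ->]]]|sV A oA|oV U x [O [oO OU UO]] Ux].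
- apply/Vs_setP => x [Ox|Nx].
    apply: (@subset_trans _ O); last exact: subsetUl.
    by apply: R0 => //; exact: semi_open_open.
  by rewrite (nowhere_dense_semi_closure1 N0 Nx) => _ ->; right.
- apply: sV; exists A, set0; split=> //; last by rewrite setU0.
  by rewrite /nowhere_dense closure0 interior0.
(* A point of [U] outside [O] lies on the frontier of [O], so its singleton is its own
   semi-closure. *)
- have [Ox|nOx] := pselect (O x).
    by apply: subset_trans OU; exact: ((Vs_setP _).1 (oV _ oO)).
  rewrite (nowhere_dense_semi_closure1 (nowhere_dense_frontier oO)) => [_ ->//|].
  by split=> //; exact: UO.
Qed.
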